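(* Let $X$ be a set with $|X|\geq 2$, let $\mathcal{B} \subset \mathrm{Br}(X)$ be a Hall set and let $A$ be an alphabetic subset of $\mathcal{B}$. For every $n \geq 2$ and every $t\in\mathcal{L}(X)$ which is an iterated Lie bracket of $n$ elements of $A$, $$\| t \|_{\mathcal{B}} \leq (n-1)!.$$
   Context: The base field is $\mathbb{K}=\mathbb{R}$ or $\mathbb{C}$; $X$ is a set (possibly infinite) with at least two elements. $\mathrm{Br}(X)$ is the free magma over $X$: the set of formal binary brackets (rooted planar binary trees with leaves labelled by elements of $X$), with product $(t_1,t_2)$. For $t\in \mathrm{Br}(X)$, $|t|$ is its number of leaves; if $t\notin X$, $t$ is written uniquely as $t=(\lambda(t),\mu(t))$. $\mathcal{L}(X)$ is the free Lie algebra over $X$ and $\mathrm{ev}:\mathrm{Br}(X)\to\mathcal{L}(X)$ is the canonical evaluation ($\mathrm{ev}(x)=x$ for $x\in X$, $\mathrm{ev}((t_1,t_2))=[\mathrm{ev}(t_1),\mathrm{ev}(t_2)]$). A Hall set is a subset $\mathcal{B}\subset\mathrm{Br}(X)$ endowed with a total order $<$ such that: (i) $X\subset\mathcal{B}$; (ii) for all $b_1,b_2\in\mathrm{Br}(X)$, $(b_1,b_2)\in\mathcal{B}$ iff $b_1,b_2\in\mathcal{B}$, $b_1<b_2$ and either $b_2\in X$ or $\lambda(b_2)\leq b_1$; (iii) for all $b_1,b_2\in\mathcal{B}$ with $(b_1,b_2)\in\mathcal{B}$, $b_1<(b_1,b_2)$. By a theorem of Viennot, $\mathrm{ev}$ is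 injective on $\mathcal{B}$ and $\mathrm{ev}(\mathcal{B})$ is a basis of $\mathcal{L}(X)$. For $u=\sum_{c\in\mathcal{B}}\alpha_c\,\mathrm{ev}(c)\in\mathcal{L}(X)$ (finite sum), $\|u\|_{\mathcal{B}}:=\sum_{c}|\alpha_c|$. A subset $A\subset\mathcal{B}$ is alphabetic when for all $a_1,a_2\in A$ with $a_1<a_2$ one has $(a_1,a_2)\in\mathcal{B}$. An iterated Lie bracket of $n$ elements of $A$ is the value in $\mathcal{L}(X)$ of an arbitrary binary bracketing (using the Lie bracket) of $n$ elements of $A$, in any order and with repetitions allowed, each element of $A$ being evaluated by $\mathrm{ev}$. *)

(* Defs.v *)
From HB Require Import structures.
From mathcomp Require Import all_boot all_order all_algebra.
From mathcomp Require Import finmap.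
From mathcomp Require Import mathcomp_extra boolp classical_sets functions.
From mathcomp Require Import cardinality fsbigop.

Set Implicit Arguments.
Unset Strict Implicit.
Unset Printing Implicit Defensive.
Import Order.TTheory GRing.Theory Num.Theory.
Local Open Scope classical_set_scope.
Local Open Scope ring_scope.

(** * Lie algebras *)

HB.mixin Record hasLieBracket (K : fieldType) L of GRing.Lmodule K L := {
  lie_br : L -> L -> L;
  lie_brDl : forall u v w : L, lie_br (u + v) w = lie_br u w + lie_br v w;
  lie_brDr : forall u v w : L, lie_br u (v + w) = lie_br u v + lie_br u w;
  lie_brZl : forall (a : K) (u v : L), lie_br (a *: u) v = a *: lie_br u v;
  lie_brZr : forall (a : K) (u v : L), lie_br u (a *: v) = a *: lie_br u v;
  lie_brxx : forall u : L, lie_br u u = 0;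
  lie_jacobi : forall u v w : L,
    lie_br u (lie_br v w) + lie_br v (lie_br w u) + lie_br w (lie_br u v) = 0
}.

#[short(type="lieAlgType")]
HB.structure Definition LieAlgebra (K : fieldType) :=
  { L of GRing.Lmodule K L & hasLieBracket K L }.

(** * The free magma *)

Inductive br (X : Type) : Type :=
| Leaf of X
| Node of br X & br X.

Arguments Leaf {X}.
Arguments Node {X}.

HB.instance Definition _ (X : Type) := gen_eqMixin (br X).
HB.instance Definition _ (X : Type) := gen_choiceMixin (br X).

Fixpoint br_eval (K : fieldType) (L : lieAlgType K) (X : Type) (f : X -> L)
    (t : br X) : L :=
  match t with
  | Leaf x => f x
  | Node t1 t2 => lie_br (br_eval f t1) (br_eval f t2)
  end.

(** * The free Lie algebra

    Formal terms in the operations of a Lie algebra, modulo the congruence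
    generated by the axioms.  The opposite of [t] is [(-1) *: t]. *)

Section FreeLie.
Variables (K : fieldType) (X : Type).

Inductive lie_term : Type :=
| LVar of X
| LZero
| LAdd of lie_term & lie_term
| LScale of K & lie_term
| LBr of lie_term & lie_term.

HB.instance Definition _ := gen_eqMixin lie_term.
HB.instance Definition _ := gen_choiceMixin lie_term.

Inductive lie_eq : lie_term -> lie_term -> Prop :=
| LE_refl t : lie_eq t t
| LE_sym t u : lie_eq t u -> lie_eq u t
| LE_trans t u v : lie_eq t u -> lie_eq u v -> lie_eq t v
| LE_add t t' u u' :
    lie_eq t t' -> lie_eq u u' -> lie_eq (LAdd t u) (LAdd t' u')
| LE_scale a t t' : lie_eq t t' -> lie_eq (LScale a t) (LScale a t')
| LE_br t t' u u' :
    lie_eq t t' -> lie_eq u u' -> lie_eq (LBr t u) (LBr t' u')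
| LE_addA t u v : lie_eq (LAdd t (LAdd u v)) (LAdd (LAdd t u) v)
| LE_addC t u : lie_eq (LAdd t u) (LAdd u t)
| LE_add0 t : lie_eq (LAdd LZero t) t
| LE_scale0 t : lie_eq (LScale 0 t) LZero
| LE_scale1 t : lie_eq (LScale 1 t) t
| LE_scaleA a b t : lie_eq (LScale a (LScale b t)) (LScale (a * b) t)
| LE_scaleDl a b t :
    lie_eq (LScale (a + b) t) (LAdd (LScale a t) (LScale b t))
| LE_scaleDr a t u :
    lie_eq (LScale a (LAdd t u)) (LAdd (LScale a t) (LScale a u))
| LE_brDl t u v : lie_eq (LBr (LAdd t u) v) (LAdd (LBr t v) (LBr u v))
| LE_brDr t u v : lie_eq (LBr t (LAdd u v)) (LAdd (LBr t u) (LBr t v))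
| LE_brZl a t u : lie_eq (LBr (LScale a t) u) (LScale a (LBr t u))
| LE_brZr a t u : lie_eq (LBr t (LScale a u)) (LScale a (LBr t u))
| LE_brxx t : lie_eq (LBr t t) LZero
| LE_jacobi t u v :
    lie_eq (LAdd (LAdd (LBr t (LBr u v)) (LBr u (LBr v t))) (LBr v (LBr t u)))
           LZero.

Definition lie_eqb : rel lie_term := fun t u => `[< lie_eq t u >].

Lemma lie_eqb_equiv : equiv_class_of lie_eqb.
Proof.
split=> [t|t u|u t v]; first exact/asboolP/LE_refl.
- by apply/asboolP/asboolP; exact: LE_sym.
- by move=> /asboolP tu /asboolP uv; apply/asboolP/(LE_trans tu uv).
Qed.

Canonical lie_eqb_equivRel := EquivRelPack lie_eqb_equiv.

Definition free_lie := {eq_quot lie_eqb}%qT.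

HB.instance Definition _ := Choice.on free_lie.
HB.instance Definition _ := EqQuotient.on free_lie.

Definition free_lie_class (t : lie_term) : free_lie := (\pi_free_lie t)%qT.

Lemma free_lie_classP t u :
  free_lie_class t = free_lie_class u <-> lie_eq t u.
Proof.
by split=> [/eqmodP /asboolP //|tu]; apply/eqmodP/asboolP.
Qed.

Lemma free_lie_classK (u : free_lie) : free_lie_class (repr u) = u.
Proof. exact: reprK. Qed.

Lemma free_lie_class_ind (P : free_lie -> Prop) :
  (forall t, P (free_lie_class t)) -> forall u, P u.
Proof. by move=> Pt u; rewrite -(free_lie_classK u). Qed.

Definition fl_gen (x : X) : free_lie := free_lie_class (LVar x).
Definition fl_add (u v : free_lie) := free_lie_class (LAdd (repr u) (repr v)).
Definition fl_scale (a : K) (u : free_lie) :=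
  free_lie_class (LScale a (repr u)).
Definition fl_br (u v : free_lie) := free_lie_class (LBr (repr u) (repr v)).

Lemma repr_class t : lie_eq (repr (free_lie_class t)) t.
Proof. by apply/free_lie_classP; rewrite free_lie_classK. Qed.

Lemma fl_addE t u :
  fl_add (free_lie_class t) (free_lie_class u) = free_lie_class (LAdd t u).
Proof. by apply/free_lie_classP/LE_add; exact: repr_class. Qed.

Lemma fl_scaleE a t :
  fl_scale a (free_lie_class t) = free_lie_class (LScale a t).
Proof. by apply/free_lie_classP/LE_scale; exact: repr_class. Qed.

Lemma fl_brE t u :
  fl_br (free_lie_class t) (free_lie_class u) = free_lie_class (LBr t u).
Proof. by apply/free_lie_classP/LE_br; exact: repr_class. Qed.

Ltac fl_axiom ax :=
  repeat (let t := fresh "t" in elim/free_lie_class_ind => t);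
  rewrite ?(fl_addE, fl_scaleE, fl_brE); apply/free_lie_classP; exact: ax.

Lemma fl_addA : associative fl_add.
Proof. by fl_axiom LE_addA. Qed.

Lemma fl_addC : commutative fl_add.
Proof. by fl_axiom LE_addC. Qed.

Lemma fl_add0 : left_id (free_lie_class LZero) fl_add.
Proof. by fl_axiom LE_add0. Qed.

Lemma fl_addN : left_inverse (free_lie_class LZero) (fl_scale (-1)) fl_add.
Proof.
elim/free_lie_class_ind => t; rewrite fl_scaleE fl_addE; apply/free_lie_classP.
apply: LE_trans (LE_scale0 t); rewrite -[0](addNr (1 : K)).
apply: LE_sym; apply: (LE_trans (LE_scaleDl _ _ _)).
by apply: LE_add; [exact: LE_refl|exact: LE_scale1].
Qed.

HB.instance Definition _ :=
  GRing.isZmodule.Build free_lie fl_addA fl_addC fl_add0 fl_addN.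

Lemma fl_scaleA a b (u : free_lie) :
  fl_scale a (fl_scale b u) = fl_scale (a * b) u.
Proof. by move: u; fl_axiom LE_scaleA. Qed.

Lemma fl_scale1 : left_id 1 fl_scale.
Proof. by fl_axiom LE_scale1. Qed.

Lemma fl_scaleDr : right_distributive fl_scale +%R.
Proof.
by move=> a; rewrite /GRing.add /=; fl_axiom LE_scaleDr.
Qed.

Lemma fl_scaleDl (v : free_lie) : {morph fl_scale^~ v : a b / a + b}.
Proof.
move=> a b; rewrite /= [in RHS]/GRing.add /=; move: v.
by fl_axiom LE_scaleDl.
Qed.

HB.instance Definition _ :=
  GRing.Zmodule_isLmodule.Build K free_lie
    fl_scaleA fl_scale1 fl_scaleDr fl_scaleDl.

Lemma fl_classD t u :
  free_lie_class t + free_lie_class u = free_lie_class (LAdd t u).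
Proof. exact: fl_addE. Qed.

Lemma fl_classZ a t : a *: free_lie_class t = free_lie_class (LScale a t).
Proof. exact: fl_scaleE. Qed.

Lemma fl_class0 : free_lie_class LZero = 0.
Proof. by []. Qed.

Ltac fl_lie_axiom ax :=
  repeat (let t := fresh "t" in elim/free_lie_class_ind => t);
  rewrite -?fl_class0 ?(fl_brE, fl_classD, fl_classZ);
  apply/free_lie_classP; exact: ax.

Lemma fl_brDl u v w : fl_br (u + v) w = fl_br u w + fl_br v w.
Proof. by move: u v w; fl_lie_axiom LE_brDl. Qed.

Lemma fl_brDr u v w : fl_br u (v + w) = fl_br u v + fl_br u w.
Proof. by move: u v w; fl_lie_axiom LE_brDr. Qed.

Lemma fl_brZl a u v : fl_br (a *: u) v = a *: fl_br u v.
Proof. by move: u v; fl_lie_axiom LE_brZl. Qed.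

Lemma fl_brZr a u v : fl_br u (a *: v) = a *: fl_br u v.
Proof. by move: u v; fl_lie_axiom LE_brZr. Qed.

Lemma fl_brxx u : fl_br u u = 0.
Proof. by move: u; fl_lie_axiom LE_brxx. Qed.

Lemma fl_jacobi u v w :
  fl_br u (fl_br v w) + fl_br v (fl_br w u) + fl_br w (fl_br u v) = 0.
Proof. by move: u v w; fl_lie_axiom LE_jacobi. Qed.

HB.instance Definition _ :=
  hasLieBracket.Build K free_lie
    fl_brDl fl_brDr fl_brZl fl_brZr fl_brxx fl_jacobi.

Lemma fl_class_br t u :
  lie_br (free_lie_class t) (free_lie_class u) = free_lie_class (LBr t u).
Proof. exact: fl_brE. Qed.

Definition ev : br X -> free_lie := br_eval fl_gen.

End FreeLie.

Section FreeLieUniversal.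
Variables (K : fieldType) (X : Type) (L : lieAlgType K) (f : X -> L).

Definition is_lie_morphism (phi : free_lie K X -> L) : Prop :=
  linear phi /\ (forall u v, phi (lie_br u v) = lie_br (phi u) (phi v)).

Fixpoint lie_term_eval (t : lie_term K X) : L :=
  match t with
  | LVar x => f x
  | LZero => 0
  | LAdd t u => lie_term_eval t + lie_term_eval u
  | LScale a t => a *: lie_term_eval t
  | LBr t u => lie_br (lie_term_eval t) (lie_term_eval u)
  end.

Lemma lie_term_eval_eq t u : lie_eq t u -> lie_term_eval t = lie_term_eval u.
Proof.
elim=> {t u} //=.
- by move=> t u v _ -> _ ->.
- by move=> t t' u u' _ -> _ ->.
- by move=> a t t' _ ->.
- by move=> t t' u u' _ -> _ ->.
- by move=> *; rewrite addrA.
- by move=> *; rewrite addrC.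
- by move=> *; rewrite add0r.
- by move=> *; rewrite scale0r.
- by move=> *; rewrite scale1r.
- by move=> *; rewrite scalerA.
- by move=> *; rewrite scalerDl.
- by move=> *; rewrite scalerDr.
- by move=> *; rewrite lie_brDl.
- by move=> *; rewrite lie_brDr.
- by move=> *; rewrite lie_brZl.
- by move=> *; rewrite lie_brZr.
- by move=> *; rewrite lie_brxx.
- by move=> *; rewrite lie_jacobi.
Qed.

Lemma free_lie_universal : exists phi : free_lie K X -> L,
  [/\ is_lie_morphism phi, forall x, phi (fl_gen K x) = f x &
    forall psi, is_lie_morphism psi -> (forall x, psi (fl_gen K x) = f x) ->
      psi =1 phi].
Proof.
pose phi (u : free_lie K X) := lie_term_eval (repr u).
have phiE t : phi (free_lie_class t) = lie_term_eval t.
  by apply: lie_term_eval_eq; exact: repr_class.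
exists phi; split.
- split=> [a|].
  + elim/free_lie_class_ind => t; elim/free_lie_class_ind => u.
    by rewrite fl_classZ fl_classD !phiE.
  + elim/free_lie_class_ind => t; elim/free_lie_class_ind => u.
    by rewrite fl_class_br !phiE.
- by move=> x; rewrite phiE.
- move=> psi [psi_lin psi_br] psi_gen; elim/free_lie_class_ind => t.
  have psi0 : psi 0 = 0.
    by have := psi_lin (-1) 0 0; rewrite scaler0 addr0 scaleN1r addNr.
  have psiD u v : psi (u + v) = psi u + psi v.
    by have := psi_lin 1 u v; rewrite !scale1r.
  have psiZ a u : psi (a *: u) = a *: psi u.
    by have := psi_lin a u 0; rewrite psi0 !addr0.
  rewrite phiE; elim: t => [x||t IHt u IHu|a t IHt|t IHt u IHu] /=.
  + exact: psi_gen.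
  + exact: psi0.
  + by rewrite -fl_classD psiD IHt IHu.
  + by rewrite -fl_classZ psiZ IHt.
  + by rewrite -fl_class_br psi_br IHt IHu.
Qed.

End FreeLieUniversal.

(** * Hall sets *)

Section Hall.
Variable X : Type.

(* Only the restriction of [lt] to [B] is relevant: in [hall_node], if [b2] is
   in [B] and is not a leaf then so is its left factor. *)
Record strict_total_order_on (T : Type) (B : set T) (lt : T -> T -> Prop) :
    Prop := {
  sto_irr : forall a, B a -> ~ lt a a;
  sto_trans : forall a b c, B a -> B b -> B c -> lt a b -> lt b c -> lt a c;
  sto_total : forall a b, B a -> B b -> a <> b -> lt a b \/ lt b a
}.

Definition leaf_or_left_le (lt : br X -> br X -> Prop) (b1 b2 : br X) : Prop :=
  match b2 with
  | Leaf _ => True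
  | Node l _ => l = b1 \/ lt l b1
  end.

Record is_hall_set (B : set (br X)) (lt : br X -> br X -> Prop) : Prop := {
  hall_order : strict_total_order_on B lt;
  hall_leaf : forall x, B (Leaf x);
  hall_node : forall b1 b2, B (Node b1 b2) <->
    [/\ B b1, B b2, lt b1 b2 & leaf_or_left_le lt b1 b2];
  hall_lt_node : forall b1 b2, B b1 -> B b2 -> B (Node b1 b2) ->
    lt b1 (Node b1 b2)
}.

Definition alphabetic (B : set (br X)) (lt : br X -> br X -> Prop)
    (A : set (br X)) : Prop :=
  A `<=` B /\ forall a1 a2, A a1 -> A a2 -> lt a1 a2 -> B (Node a1 a2).

Inductive iterated_bracket (K : fieldType) (A : set (br X)) :
    nat -> free_lie K X -> Prop :=
| IB_elt a : A a -> iterated_bracket A 1 (ev K a)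
| IB_br m n u v : iterated_bracket A m u -> iterated_bracket A n v ->
    iterated_bracket A (m + n) (lie_br u v).

Definition hall_decomposition (K : fieldType) (B : set (br X))
    (u : free_lie K X) (alpha : br X -> K) : Prop :=
  [/\ finite_set [set c | alpha c != 0], [set c | alpha c != 0] `<=` B &
      u = \sum_(c \in B) alpha c *: ev K c].

(* When [B] is a Hall set, [ev] maps [B] injectively onto a basis (Viennot), so
   [u] has exactly one decomposition and the default value is never used. *)
Definition hall_coord (K : fieldType) (B : set (br X)) (u : free_lie K X) :
    br X -> K :=
  xget (fun=> 0) [set alpha | hall_decomposition B u alpha].

(* Valued in [K], so that the real and complex cases are treated uniformly; it
   is a sum of absolute values, hence a nonnegative real element of [K]. *)
Definition hall_norm (K : numFieldType) (B : set (br X)) (u : free_lie K X) :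
    K :=
  \sum_(c \in B) `|hall_coord B u c|.

End Hall.

(* Main.v *)
(** Viennot's theorem: concatenation of letters, followed by rewriting into
    nonincreasing products of Hall elements, lets the free Lie algebra act on
    such products, and [ev b] sends the empty product to [b].  Hence each
    coordinate along [ev b] is a linear functional, and Hall decompositions are
    unique.

    The bound is a Lazard elimination.  Let [a] be the least element of [A]
    occurring in [t], with [m] occurrences and [p] other factors.  The set
    [A' = {b | (a, b) in B}] is alphabetic, contains the other factors and is
    stable under [b |-> (a, b)].  As [ev a] acts as a derivation, [t] is a signed
    sum of at most [p (p + 1) ... (p + m - 1)] brackets of [p] elements of [A'],
    and induction on the number of factors gives
    [p (p + 1) ... (p + m - 1) (p - 1)! = (n - 1)!] signed Hall elements. *)

Require Import Defs.
From HB Require Import structures.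
From mathcomp Require Import all_boot all_order all_algebra.
From mathcomp Require Import finmap boolp cardinality fsbigop.
From mathcomp Require Import ring zify.
From mathcomp Require Import classical_sets.

Set Implicit Arguments.
Unset Strict Implicit.
Unset Printing Implicit Defensive.
Import Order.TTheory GRing.Theory Num.Theory.
Local Open Scope classical_set_scope.
Local Open Scope ring_scope.

(** * Action of the free Lie algebra on products of Hall elements, and dual functionals *)

Section HallInsertion.
Variables (K : fieldType) (X : Type) (B : set (br X)).
Variable lt : br X -> br X -> Prop.
Implicit Types (g h : br X) (s r : seq (br X)) (phi : seq (br X) -> K).

(* Expansion of the product [s_k ... s_1 h] (the head of [s] is its rightmost
   factor) into products of Hall elements in nonincreasing order, obtained by
   moving [h] to the left with [g h = (g, h) + h g]. *)
Fixpoint hall_insert s h : seq (seq (br X)) :=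
  if s is g :: s' then
    if `[< lt g h >] then
      hall_insert s' (Node g h) ++ [seq g :: r | r <- hall_insert s' h]
    else [:: h :: s]
  else [:: [:: h]].

(* The generators act freely, so this is a representation without anything to
   check; functions of [s] rather than formal sums make every operator linear. *)
Fixpoint hall_act (t : lie_term K X) phi s : K :=
  match t with
  | LVar x => \sum_(r <- hall_insert s (Leaf x)) phi r
  | LZero => 0
  | LAdd t u => hall_act t phi s + hall_act u phi s
  | LScale a t => a * hall_act t phi s
  | LBr t u => hall_act t (hall_act u phi) s - hall_act u (hall_act t phi) s
  end.

Lemma hall_act_linear t k phi psi s :
  hall_act t (fun r => k * phi r + psi r) s
  = k * hall_act t phi s + hall_act t psi s.
Proof.
elim: t k phi psi s => [x||t IHt u IHu|a t IHt|t IHt u IHu] k phi psi s /=.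
- by rewrite big_split mulr_sumr.
- by rewrite mulr0 addr0.
- by rewrite IHt IHu; ring.
- by rewrite IHt; ring.
- rewrite (_ : hall_act u _ = fun r => k * hall_act u phi r + hall_act u psi r);
    last exact/funext/IHu.
  rewrite (_ : hall_act t (fun r => _ * phi r + _)
             = fun r => k * hall_act t phi r + hall_act t psi r);
    last exact/funext/IHt.
  by rewrite IHt IHu; ring.
Qed.

Lemma hall_act0 t s : hall_act t (fun=> 0) s = 0.
Proof.
have := hall_act_linear t (-1) (fun=> 0) (fun=> 0) s.
by rewrite mulr0 addr0 mulN1r addNr.
Qed.

Lemma hall_actD t phi psi s :
  hall_act t (fun r => phi r + psi r) s = hall_act t phi s + hall_act t psi s.
Proof.
rewrite -[hall_act t phi s]mul1r -hall_act_linear; congr (hall_act t _ s).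
by apply/funext => r; rewrite mul1r.
Qed.

Lemma hall_actZ t k phi s :
  hall_act t (fun r => k * phi r) s = k * hall_act t phi s.
Proof.
rewrite -[RHS]addr0 -(hall_act0 t s) -hall_act_linear; congr (hall_act t _ s).
by apply/funext => r; rewrite addr0.
Qed.

Lemma hall_actB t phi psi s :
  hall_act t (fun r => phi r - psi r) s = hall_act t phi s - hall_act t psi s.
Proof.
rewrite addrC -mulN1r -hall_act_linear; congr (hall_act t _ s).
by apply/funext => r; rewrite mulN1r addrC.
Qed.

(** Brackets act as commutators of operators linear in [phi], so every axiom becomes an operator
    identity and the action descends to the quotient. *)
Lemma hall_act_eq t u : lie_eq t u -> hall_act t = hall_act u.
Proof.
suff E : lie_eq t u -> forall phi s, hall_act t phi s = hall_act u phi s.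
  by move=> tu; apply/funext => phi; apply/funext => s; exact: E.
elim=> {t u} //=.
- by move=> t u v _ tu _ uv phi s; rewrite tu.
- by move=> t t' u u' _ tt' _ uu' phi s; rewrite tt' uu'.
- by move=> a t t' _ tt' phi s; rewrite tt'.
- move=> t t' u u' _ tt' _ uu' phi s.
  rewrite tt' uu'.
  rewrite (_ : hall_act t phi = hall_act t' phi); last exact/funext/tt'.
  by rewrite (_ : hall_act u phi = hall_act u' phi) //; exact/funext/uu'.
- by move=> *; ring.
- by move=> *; ring.
- by move=> *; ring.
- by move=> *; ring.
- by move=> *; ring.
- by move=> *; ring.
- by move=> *; ring.
- by move=> *; ring.
- by move=> t u v phi s; rewrite hall_actD; ring.
- by move=> t u v phi s; rewrite hall_actD; ring.
- by move=> a t u phi s; rewrite hall_actZ; ring.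
- by move=> a t u phi s; rewrite hall_actZ; ring.
- by move=> *; ring.
- by move=> t u v phi s; rewrite !hall_actB; ring.
Qed.

Definition fl_act (u : free_lie K X) := hall_act (repr u).

Lemma fl_actE t : fl_act (free_lie_class t) = hall_act t.
Proof. exact/hall_act_eq/repr_class. Qed.

Lemma fl_actD u v phi s : fl_act (u + v) phi s = fl_act u phi s + fl_act v phi s.
Proof.
elim/free_lie_class_ind: u => u; elim/free_lie_class_ind: v => v.
by rewrite fl_classD !fl_actE.
Qed.

Lemma fl_actZ a u phi s : fl_act (a *: u) phi s = a * fl_act u phi s.
Proof. by elim/free_lie_class_ind: u => u; rewrite fl_classZ !fl_actE. Qed.

Lemma fl_act_br u v phi s :
  fl_act (lie_br u v) phi s
  = fl_act u (fl_act v phi) s - fl_act v (fl_act u phi) s.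
Proof.
elim/free_lie_class_ind: u => u; elim/free_lie_class_ind: v => v.
by rewrite fl_class_br !fl_actE.
Qed.

Hypothesis hB : is_hall_set B lt.

Lemma hall_trans a b c : B a -> B b -> B c -> lt a b -> lt b c -> lt a c.
Proof. exact: (sto_trans (hall_order hB)). Qed.

Lemma hall_le_lt_trans a b c :
  B a -> B b -> B c -> a = b \/ lt a b -> lt b c -> lt a c.
Proof. by move=> Ba Bb Bc [->//|]; exact: hall_trans. Qed.

Lemma hall_lt_le_trans a b c :
  B a -> B b -> B c -> lt a b -> b = c \/ lt b c -> lt a c.
Proof. by move=> Ba Bb Bc ab [<-//|]; exact: hall_trans. Qed.

Lemma hall_left_lt a b : B (Node a b) -> lt a (Node a b).
Proof. by move=> Bab; have [Ba Bb _ _] := (hall_node hB a b).1 Bab;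
  exact: (hall_lt_node hB). Qed.

Lemma hall_left_leW a b h : B a -> B b -> B h -> a = b \/ lt a b ->
  leaf_or_left_le lt a h -> leaf_or_left_le lt b h.
Proof.
case: h => [//|l r] Ba Bb Bh ab /= la; have [Bl _ _ _] := (hall_node hB l r).1 Bh.
by case: la => [->//|la]; right; exact: hall_lt_le_trans ab.
Qed.

Lemma hall_left_le_lt a h : B a -> B h -> h = a \/ lt h a ->
  leaf_or_left_le lt a h.
Proof.
case: h => [//|l r] Ba Bh ha; right; have [Bl _ _ _] := (hall_node hB l r).1 Bh.
exact: hall_lt_le_trans (hall_left_lt Bh) ha.
Qed.

Definition hall_ge a s := forall g, g \in s -> B g /\ (a = g \/ lt a g).

(** The head is the rightmost factor, hence the least one of a nonincreasing product. *)
Fixpoint hall_sorted s : Prop :=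
  if s is g :: s' then [/\ B g, hall_ge g s' & hall_sorted s'] else True.

(** Ensures that, for Hall elements [g < h], the bracket [(g, h)] created by an exchange is again a
    Hall element. *)
Definition insertable s h := forall g, g \in s -> leaf_or_left_le lt g h.

Lemma hall_ge_cons a g s : B g -> a = g \/ lt a g -> hall_ge a s ->
  hall_ge a (g :: s).
Proof. by move=> Bg ag as_ c; rewrite inE => /orP[/eqP->//|/as_]. Qed.

Lemma hall_sorted_mem s g : hall_sorted s -> g \in s -> B g.
Proof.
by elim: s => //= c s IH [Bc _ /IH] {}IH; rewrite inE => /orP[/eqP->|/IH].
Qed.

(** When [g < h], the induction runs with two lower bounds: [g], to keep [g :: q] sorted, and [a].
    The bracket [(g, h)] exceeds [g], and it can be inserted further because its left factor [g] is
    at most every factor of the tail. *)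
Lemma hall_insert_ge a s h r : B a -> B h -> lt a h -> hall_ge a s ->
  hall_sorted s -> insertable s h -> r \in hall_insert s h ->
  hall_ge a r /\ hall_sorted r.
Proof.
elim: s a h r => [|g s IH] a h r Ba Bh ah as_ /=.
  move=> _ _; rewrite inE => /eqP->; split=> //.
  by apply: hall_ge_cons => //; right.
move=> [Bg gs ss] hs.
have ag : a = g \/ lt a g by have [] := as_ g; rewrite ?inE ?eqxx.
have as' : hall_ge a s by move=> c cs; apply: as_; rewrite inE cs orbT.
have hs' : insertable s h by move=> c cs; apply: hs; rewrite inE cs orbT.
case: asboolP => gh.
- have Bgh : B (Node g h).
    by apply/(hall_node hB); split=> //; apply: hs; rewrite inE eqxx.
  rewrite mem_cat => /orP[|/mapP[q qI ->]].
  + apply: IH => //; first exact: (hall_le_lt_trans Ba Bg Bgh ag (hall_left_lt Bgh)).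
    by move=> c cs; have [_] := gs _ cs.
  + have [gq sq] := IH g h q Bg Bh gh gs ss hs' qI.
    have [aq _] := IH a h q Ba Bh ah as' ss hs' qI.
    by split; [exact: hall_ge_cons|].
- rewrite inE => /eqP->; split; first by apply: hall_ge_cons => //; right.
  split=> //.
  have hg : h = g \/ lt h g.
    have [->|hg] := pselect (h = g); first by left.
    by have [?|//] := sto_total (hall_order hB) Bh Bg hg; right.
  apply: hall_ge_cons => // c cs; have [Bc gc] := gs _ cs; split=> //.
  case: hg gc => [->//|hg] gc; right; exact: hall_lt_le_trans gc.
Qed.

Lemma hall_insert_le a s : B a -> hall_ge a s ->
  hall_insert s a = [:: a :: s].
Proof.
case: s => [//|g s] Ba as_ /=; have [Bg ag] := as_ g (mem_head _ _).
case: asboolP => // ga; case: (sto_irr (hall_order hB) Ba).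
exact: hall_le_lt_trans ag ga.
Qed.

(* For [h = (a, b)] and [a] below [s]: the product [s a b] is expanded by
   [hall_insert (a :: s) b], whose terms keeping [a] last are those of [s b a]. *)
Lemma fl_act_ev h s phi : B h -> hall_sorted s -> insertable s h ->
  fl_act (ev K h) phi s = \sum_(r <- hall_insert s h) phi r.
Proof.
elim: h s phi => [x|a IHa b IHb] s phi Bh ss hs; first by rewrite fl_actE.
have [Ba Bb ab lab] := (hall_node hB a b).1 Bh.
have as_ : hall_ge a s.
  by move=> g gs; split; [exact: hall_sorted_mem gs|exact: hs].
have ins_a r : hall_ge a r -> hall_sorted r ->
    forall psi, fl_act (ev K a) psi r = psi (a :: r).
  move=> ar sr psi; rewrite IHa //.
    by rewrite hall_insert_le// big_seq1.
  by move=> g /ar [Bg ag]; exact: hall_left_le_lt.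
have bs : insertable s b.
  by move=> g /as_ [Bg ag]; exact: (hall_left_leW Ba).
have eq_b : fl_act (ev K b) phi (a :: s)
    = \sum_(r <- hall_insert s (Node a b)) phi r
      + \sum_(r <- hall_insert s b) phi (a :: r).
  rewrite IHb //=; last by move=> g; rewrite inE => /orP[/eqP->//|/bs].
  by case: asboolP => // _; rewrite big_cat big_map.
rewrite [ev K _]/= fl_act_br ins_a// eq_b IHb//.
rewrite [X in _ - X](_ : _ = \sum_(r <- hall_insert s b) phi (a :: r)) ?addrK//.
apply: eq_big_seq => r rI.
by have [ar sr] := hall_insert_ge Ba Bb ab as_ ss bs rI; exact: ins_a.
Qed.

(** The coefficient of the one-factor product [c] in the image of the empty product under [u]. *)
Definition hall_dual (c : br X) (u : free_lie K X) : K^o :=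
  fl_act u (fun s => (s == [:: c])%:R) [::].

Lemma hall_dual_ev b c : B b -> hall_dual c (ev K b) = (b == c)%:R.
Proof. by move=> Bb; rewrite /hall_dual fl_act_ev// big_seq1 eqseq_cons andbT. Qed.

Lemma hall_dual_is_linear c : linear (hall_dual c).
Proof. by move=> a u v; rewrite /hall_dual fl_actD fl_actZ. Qed.

HB.instance Definition _ c := GRing.isLinear.Build K (free_lie K X) K^o _
  (hall_dual c) (hall_dual_is_linear c).

End HallInsertion.

(** * Signed sums with a bounded number of terms *)

Section SignedSums.
Variables (K : fieldType) (L : lieAlgType K).
Implicit Types (S : set L) (u v : L).

(** As [SS0] accepts every [N], the index is an upper bound on the number of terms, which also
    covers brackets that vanish. *)
Inductive signed_sum S : nat -> L -> Prop :=
| SS0 N : signed_sum S N 0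
| SS_cons N (e : bool) v u : S v -> signed_sum S N u ->
    signed_sum S N.+1 ((-1) ^+ e *: v + u).

Lemma signed_sum1 S u : S u -> signed_sum S 1 u.
Proof.
move=> Su; rewrite -[u]addr0 -[u]scale1r.
by apply: (SS_cons (N := 0%N) false Su); exact: SS0.
Qed.

Lemma signed_sumW S S' M N u : (M <= N)%N -> S `<=` S' ->
  signed_sum S M u -> signed_sum S' N u.
Proof.
move=> MN SS' h; elim: h N MN => {M u} [*|M e v u Sv _ IH [//|N] MN].
  exact: SS0.
by apply: SS_cons; [exact: SS'|exact: IH].
Qed.

Lemma signed_sumD S M N u v :
  signed_sum S M u -> signed_sum S N v -> signed_sum S (M + N) (u + v).
Proof.
move=> + hv; elim=> {M u} [M|M e w u Sw _ IH].
  by rewrite add0r; apply: signed_sumW hv; rewrite // leq_addl.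
by rewrite -addrA addSn; exact: SS_cons.
Qed.

Lemma signed_sum_sign S N (e : bool) u :
  signed_sum S N u -> signed_sum S N ((-1) ^+ e *: u).
Proof.
elim=> {N u} [N|N e' w u Sw _ IH]; first by rewrite scaler0; exact: SS0.
by rewrite scalerDr scalerA -signr_addb; exact: SS_cons.
Qed.

Lemma signed_sum_bind S S' M N u : signed_sum S M u ->
  (forall v, S v -> signed_sum S' N v) -> signed_sum S' (M * N) u.
Proof.
move=> + SS'; elim=> {M u} [M|M e w u Sw _ IH]; first exact: SS0.
by rewrite mulSn; apply: signed_sumD => //; apply/signed_sum_sign/SS'.
Qed.

Lemma lie_0br u : lie_br 0 u = 0.
Proof. by rewrite -(scale0r 0) lie_brZl !scale0r. Qed.

Lemma lie_br0 u : lie_br u 0 = 0.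
Proof. by rewrite -(scale0r 0) lie_brZr !scale0r. Qed.

Lemma lie_br_anti u v : lie_br u v = (-1) ^+ true *: lie_br v u.
Proof.
apply/eqP; rewrite scaleN1r -addr_eq0; apply/eqP.
have := lie_brxx (u + v).
by rewrite lie_brDl !lie_brDr !lie_brxx add0r addr0.
Qed.

Lemma lie_br_derivation u v w :
  lie_br u (lie_br v w) = lie_br (lie_br u v) w + lie_br v (lie_br u w).
Proof.
have /eqP := lie_jacobi u v w; rewrite -addrA addr_eq0 => /eqP ->.
rewrite opprD addrC [lie_br w (lie_br u v)]lie_br_anti [lie_br w u]lie_br_anti.
by rewrite !scaleN1r opprK -scaleN1r lie_brZr !scaleN1r opprK.
Qed.

Lemma signed_sum_br S S' S'' M N u v : signed_sum S M u -> signed_sum S' N v ->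
  (forall x y, S x -> S' y -> S'' (lie_br x y)) ->
  signed_sum S'' (M * N) (lie_br u v).
Proof.
move=> hu hv SS; elim: hu => {M u} [M|M e x u Sx _ IH].
  by rewrite lie_0br; exact: SS0.
rewrite lie_brDl lie_brZl mulSn; apply: signed_sumD => //.
apply: signed_sum_sign; elim: hv => {N v IH} [N|N e' y v Sy _ IH].
  by rewrite lie_br0; exact: SS0.
by rewrite lie_brDr lie_brZr; apply: SS_cons => //; exact: SS.
Qed.

End SignedSums.

Lemma leq_ffact2r m n p : (n <= p)%N -> (n ^_ m <= p ^_ m)%N.
Proof.
elim: m n p => [//|m IH] n p np; rewrite !ffactnS leq_mul//.
by apply: IH; lia.
Qed.

Lemma ffactnD n m p : (n ^_ (m + p) = n ^_ m * (n - m) ^_ p)%N.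
Proof.
elim: m n => [|m IH] n; first by rewrite subn0 mul1n.
by rewrite addSn !ffactnS IH mulnA; congr (_ * _ ^_ _)%N; lia.
Qed.

(** [(p + m).-1 ^_ m] is the rising product [p (p + 1) ... (p + m - 1)]. Splitting the first [m]
    factors off the right side leaves [(p + q + n).-1 ^_ n]; the two pieces dominate the two factors
    on the left. *)
Lemma ffact_pred_mul p q m n : (0 < p)%N -> (0 < q)%N ->
  ((p + m).-1 ^_ m * (q + n).-1 ^_ n <= (p + q + (m + n)).-1 ^_ (m + n))%N.
Proof.
by move=> p0 q0; rewrite ffactnD leq_mul//; apply: leq_ffact2r; lia.
Qed.

(** * Lazard elimination of the least element *)

Section Elimination.
Variables (K : fieldType) (X : Type) (B : set (br X)).
Variable lt : br X -> br X -> Prop.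
Hypothesis hB : is_hall_set B lt.
Local Notation FL := (free_lie K X).
Implicit Types (A C : set (br X)) (a b c : br X) (u v : FL).

Inductive mixed_bracket a C : nat -> nat -> FL -> Prop :=
| MB_min : mixed_bracket a C 0 1 (ev K a)
| MB_elt c : C c -> mixed_bracket a C 1 0 (ev K c)
| MB_br p m q n u v : mixed_bracket a C p m u -> mixed_bracket a C q n v ->
    mixed_bracket a C (p + q) (m + n) (lie_br u v).

Lemma mixed_bracketW a C C' p m u : C `<=` C' ->
  mixed_bracket a C p m u -> mixed_bracket a C' p m u.
Proof.
move=> CC'; elim=> {p m u} *; [exact: MB_min|exact/MB_elt/CC'|exact: MB_br].
Qed.

(** For brackets whose two sides have different minima: all factors of the side with the larger
    minimum, that minimum included, lie above the smaller one and move to the first count. *)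
Lemma mixed_bracket_absorb a C C' p m u : C' a -> C `<=` C' -> forall b,
  mixed_bracket a C p m u -> mixed_bracket b C' (p + m) 0 u.
Proof.
move=> C'a CC' b; elim=> {p m u} [|c Cc|p m q n u v _ IHu _ IHv].
- exact: MB_elt.
- exact/MB_elt/CC'.
- by rewrite addnACA -[0%N]/(0 + 0)%N; exact: MB_br.
Qed.

Lemma iterated_bracket_min A n u : A `<=` B -> iterated_bracket A n u ->
  exists a p m, [/\ A a, (p + m)%N = n, (0 < m)%N &
    mixed_bracket a [set c | A c /\ lt a c] p m u].
Proof.
move=> AB; elim=> {n u} [a Aa|m n u v _ [a [p [i [Aa <- i0 mu]]]]
    _ [b [q [j [Ab <- j0 mv]]]]].
  by exists a, 0%N, 1%N; split=> //; exact: MB_min.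
have gt_sub c d : A c -> A d -> lt c d ->
    [set x | A x /\ lt d x] `<=` [set x | A x /\ lt c x].
  move=> Ac Ad cd x [Ax dx]; split=> //.
  by apply: (hall_trans hB) dx => //; exact: AB.
have [eab|ab] := pselect (a = b).
  exists a, (p + q)%N, (i + j)%N; split; [by []|by rewrite addnACA|by lia|].
  by apply: MB_br => //; rewrite eab.
have [ltab|ltba] := sto_total (hall_order hB) (AB _ Aa) (AB _ Ab) ab.
- exists a, (p + (q + j))%N, (i + 0)%N; split; [by []|by lia|by lia|].
  by apply: MB_br => //; apply: (mixed_bracket_absorb (C' := [set c | _]) _ _ _ mv);
    [|exact: gt_sub].
- exists b, ((p + i) + q)%N, (0 + j)%N; split; [by []|by lia|by lia|].
  by apply: MB_br => //; apply: (mixed_bracket_absorb (C' := [set c | _]) _ _ _ mu);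
    [|exact: gt_sub].
Qed.

Variable a : br X.
Local Notation A' := [set b | B (Node a b)].

(** [a < (a, b)] by the third Hall axiom, and the left factor of [(a, b)] is [a] itself. *)
Lemma hall_node_closed b : A' b -> A' (Node a b).
Proof.
move=> Bab; have [Ba Bb ab _] := (hall_node hB a b).1 Bab.
by apply/(hall_node hB); split=> //; [exact: hall_left_lt hB _ _ _|left].
Qed.

(** If [c] is not a leaf, its left factor is at most [a], and [a < b]. *)
Lemma alphabetic_elimination : alphabetic B lt A'.
Proof.
split=> [b /(hall_node hB)[]//|b c Bab Bac bc].
have [Ba Bb ab _] := (hall_node hB a b).1 Bab.
have [_ Bc ac lac] := (hall_node hB a c).1 Bac.
by apply/(hall_node hB); split=> //; apply: (hall_left_leW hB Ba) lac => //; right.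
Qed.

(** Leibniz rule: each of the [p] terms replaces one factor [b] by [(a, b)], which stays in [A']. *)
Lemma signed_sum_ad p u : iterated_bracket A' p u ->
  signed_sum (iterated_bracket A' p) p (lie_br (ev K a) u).
Proof.
elim=> {p u} [b A'b|p q u v hu IHu hv IHv].
  by apply: signed_sum1; apply: (IB_elt K (hall_node_closed A'b)).
rewrite lie_br_derivation; apply: signed_sumD.
- rewrite -[X in signed_sum _ X]muln1; apply: signed_sum_br IHu (signed_sum1 hv) _.
  by move=> x y; exact: IB_br.
- rewrite -[X in signed_sum _ X]mul1n; apply: signed_sum_br (signed_sum1 hu) IHv _.
  by move=> x y; exact: IB_br.
Qed.

(** Sides with [p = 0] occur in the induction: copies of [a] alone bracket to zero unless there is
    just one. If both sides have factors in [A'], the counts multiply and [ffact_pred_mul]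
    applies. *)
Lemma signed_sum_mixed p m u : mixed_bracket a A' p m u ->
  if p == 0%N then u = 0 \/ m = 1%N /\ u = ev K a
  else signed_sum (iterated_bracket A' p) ((p + m).-1 ^_ m) u.
Proof.
have ad q n v : (0 < q)%N ->
    signed_sum (iterated_bracket A' q) ((q + n).-1 ^_ n) v ->
    signed_sum (iterated_bracket A' q) ((q + n.+1).-1 ^_ n.+1)
      (lie_br (ev K a) v).
  move=> q0 hv.
  have ha : signed_sum [set ev K a] 1 (ev K a) by exact: signed_sum1.
  have hav : signed_sum [set lie_br (ev K a) y | y in iterated_bracket A' q]
      (1 * (q + n).-1 ^_ n) (lie_br (ev K a) v).
    by apply: signed_sum_br ha hv _ => x y -> hy; exists y.
  have : signed_sum (iterated_bracket A' q) (1 * (q + n).-1 ^_ n * q)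
      (lie_br (ev K a) v).
    by apply: signed_sum_bind hav _ => _ [y hy <-]; exact: signed_sum_ad.
  apply: signed_sumW => //.
  (* [signed_sum_ad] multiplies the count by [q], while the falling factorial gains the factor
     [q + n]. *)
  by rewrite mul1n addnS /= ffactnS mulnC leq_mul// leq_addr.
elim=> {p m u} [|c A'c|p m q n u v _ IHu _ IHv] /=; first by right.
  by rewrite ffactn0; apply/signed_sum1/IB_elt.
rewrite addn_eq0; move: IHu IHv.
case: (posnP p) => [->|p0]; case: (posnP q) => [->|q0]; rewrite /=.
- case=> [->|[-> ->]]; case=> [->|[-> ->]];
    by left; rewrite ?lie_0br ?lie_br0 ?lie_brxx.
- rewrite add0n; case=> [->|[-> ->]] hv.
    by rewrite lie_0br; exact: SS0.
  exact: ad.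
- rewrite addn0 => hu; case=> [->|[-> ->]].
    by rewrite lie_br0; exact: SS0.
  by rewrite lie_br_anti addn1; apply/signed_sum_sign/ad.
- move=> hu hv.
  apply: signed_sumW (signed_sum_br (S'' := iterated_bracket A' (p + q)) hu hv _).
  + exact: ffact_pred_mul.
  + by [].
  + by move=> x y; exact: IB_br.
Qed.

End Elimination.

(** * The factorial count and the norm bound *)

Section HallBound.
Variables (X : Type) (B : set (br X)) (lt : br X -> br X -> Prop).
Hypothesis hB : is_hall_set B lt.

Lemma iterated_bracket_signed_sum (K : fieldType) A n (u : free_lie K X) :
  alphabetic B lt A -> iterated_bracket A n u ->
  signed_sum [set ev K b | b in B] (n.-1)`! u.
Proof.
elim/ltn_ind: n A u => n IH A u [AB AN] /(iterated_bracket_min hB AB).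
move=> [a [p [m [Aa pmn m0 /mixed_bracketW mu]]]].
(* Alphabeticity puts the elements of [A] above [a] into the new alphabetic set, which replaces [A]
   in the induction. *)
have {}mu : mixed_bracket a [set b | B (Node a b)] p m u.
  by apply: mu => c [Ac ac]; exact: AN.
have := signed_sum_mixed hB mu; case: (posnP p) => [p0|p0].
  (* Without other factors, [u] is zero or, when [n = 1], the single Hall element [ev K a], in
     accordance with [0! = 1]. *)
  case=> [->|[m1 ->]]; first exact: SS0.
  by rewrite -pmn p0 m1; apply: signed_sum1; exists a => //; exact: AB.
move=> hu.
have pn : (p < n)%N by lia.
have := signed_sum_bind hu (fun v => IH p pn _ v (alphabetic_elimination hB a)).
apply: signed_sumW => //; rewrite pmn -(@ffact_fact n.-1 m); last by lia.
by rewrite (_ : n.-1 - m = p.-1)%N//; lia.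
Qed.

Lemma signed_sum_seq (K : fieldType) N (u : free_lie K X) :
  signed_sum [set ev K b | b in B] N u -> exists l : seq (bool * br X),
    [/\ (size l <= N)%N, forall q, q \in l -> B q.2 &
      u = \sum_(q <- l) (-1) ^+ q.1 *: ev K q.2].
Proof.
elim=> {N u} [N|N e _ u [b Bb <-] _ [l [lN lB ->]]].
  by exists [::]; split=> //; rewrite big_nil.
exists ((e, b) :: l); split=> //; last by rewrite big_cons.
by move=> q; rewrite inE => /orP[/eqP->//|/lB].
Qed.

(** Apply the functional to the finite sum. The right side does not involve [alpha], so
    decompositions are unique. *)
Lemma hall_decomposition_dual (K : fieldType) (u : free_lie K X) alpha c :
  hall_decomposition B u alpha -> alpha c = hall_dual lt c u.
Proof.
move=> [/finite_fsetP[s sE] sB ->].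
have mem_s b : alpha b != 0 -> b \in s.
  by move=> h; have : [set` s] b by rewrite -sE.
have s_sub b : b \in s -> B b.
  by move=> bs; apply: sB; rewrite sE.
rewrite (fsbigE (enum_fset s)) ?fset_uniq//; last first.
  move=> b _; apply: contraNeq; rewrite scaler_eq0 negb_or => /andP[h _].
  exact: mem_s.
rewrite linear_sum big_seq_cond.
have -> : \sum_(b <- s | (b \in s) && (b \in B)) hall_dual lt c (alpha b *: ev K b)
    = \sum_(b <- s) alpha b * (b == c)%:R.
  rewrite [RHS]big_seq; apply: eq_big => [b|b /andP[bs _]].
    by case: (boolP (b \in s)) => //= bs; apply/mem_set/s_sub.
  by rewrite linearZ /= (hall_dual_ev _ hB)//; exact: s_sub.
have [cs|cs] := boolP (c \in s).
  rewrite (big_rem c)//= eqxx mulr1 big1_seq ?addr0// => b /=.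
  rewrite mem_rem_uniq ?fset_uniq// inE => /andP[/negPf-> _].
  by rewrite mulr0.
rewrite big1_seq => [|b /= bs]; last first.
  by case: eqVneq bs cs => [->->//|_ _ _]; rewrite mulr0.
by apply/eqP; apply: contraNT cs; exact: mem_s.
Qed.

Lemma hall_norm_signed_sum (K : numFieldType) N (u : free_lie K X) :
  signed_sum [set ev K b | b in B] N u -> hall_norm B u <= N%:R.
Proof.
move=> /signed_sum_seq[l [lN lB uE]].
(* Entries of [l] may repeat or cancel; [alpha c] gathers the signs of those at [c]. *)
pose alpha c : K := \sum_(q <- l) (-1) ^+ q.1 * (q.2 == c)%:R.
pose s := undup [seq q.2 | q <- l].
have l_s q : q \in l -> q.2 \in s by move=> ql; rewrite mem_undup map_f.
have s_sub b : b \in s -> B b.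
  by rewrite mem_undup => /mapP[q ql ->]; exact: lB.
have alpha_s c : c \notin s -> alpha c = 0.
  move=> cs; rewrite /alpha big1_seq// => q /= /l_s.
  by case: eqVneq cs => [->/negPf->//|_ _ _]; rewrite mulr0.
have sumE (V : nmodType) (F : br X -> V) : (forall c, c \notin s -> F c = 0) ->
    \sum_(c \in B) F c = \sum_(c <- s) F c.
  move=> Fs; rewrite (fsbigE s) ?undup_uniq//; last by move=> c _; exact: Fs.
  rewrite [RHS]big_seq [LHS]big_seq_cond; apply: eq_bigl => c.
  by case: (boolP (c \in s)) => //= cs; apply/mem_set/s_sub.
have pick (V : lmodType K) (F : br X -> V) q : q \in l ->
    \sum_(c <- s) (q.2 == c)%:R *: F c = F q.2.
  move=> ql; rewrite (big_rem q.2) ?l_s//= eqxx scale1r big1_seq ?addr0// => c /=.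
  rewrite mem_rem_uniq ?undup_uniq// inE eq_sym => /andP[/negPf-> _].
  by rewrite scale0r.
have alphaP : hall_decomposition B u alpha.
  split.
  - apply: (sub_finite_set (B := [set` s])) => [c /= ac|]; last first.
      exact: finite_seq.
    by apply: contraNT ac => /alpha_s->.
  - by move=> c /= ac; apply: s_sub; apply: contraNT ac => /alpha_s->.
  - transitivity (\sum_(c <- s) alpha c *: ev K c); last first.
      by symmetry; apply: sumE => c /alpha_s->; rewrite scale0r.
    rewrite uE; under [RHS]eq_bigr do rewrite scaler_suml.
    rewrite exchange_big /=; apply: eq_big_seq => q ql.
    under eq_bigr do rewrite -scalerA.
    by rewrite -scaler_sumr pick.
(* By uniqueness the decomposition chosen by [xget] is [alpha]. *)
have coordE : hall_coord B u = alpha.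
  apply: xget_unique => // beta bP; apply/funext => c.
  by rewrite (hall_decomposition_dual c bP) (hall_decomposition_dual c alphaP).
rewrite /hall_norm coordE sumE => [|c /alpha_s->]; last by rewrite normr0.
(* By the triangle inequality each entry of [l] contributes at most one, at a single [c]; exchanging
   the sums counts the entries. *)
apply: (@le_trans _ _ (size l)%:R); last by rewrite ler_nat.
apply: (@le_trans _ _ (\sum_(c <- s) \sum_(q <- l) (q.2 == c)%:R)).
  apply: ler_sum => c _; apply: le_trans (ler_norm_sum _ _ _) _.
  by apply: ler_sum => q _; rewrite normrMsign normr_nat.
rewrite exchange_big /= -sum1_size natr_sum.
rewrite [leLHS]big_seq [leRHS]big_seq; apply: ler_sum => q ql.
rewrite -[leRHS](pick K^o (fun=> 1) q ql).
by apply: ler_sum => c _; rewrite [leRHS]mulr1.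
Qed.

End HallBound.

Theorem theorem1p2 (K : numFieldType) (X : Type)
    (hX : exists x y : X, x <> y)
    (B : set (br X)) (lt : br X -> br X -> Prop) (hB : is_hall_set B lt)
    (A : set (br X)) (hA : alphabetic B lt A)
    (n : nat) (hn : (2 <= n)%N)
    (t : free_lie K X) (ht : iterated_bracket A n t) :
  hall_norm B t <= (n.-1)`!%:R.
Proof.
exact/(hall_norm_signed_sum hB)/(iterated_bracket_signed_sum hB hA).
Qed.
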